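(* (1D generalized LF splitting.) If $\hat{\mathbf U}=(\hat\rho,\hat{\mathbf m},\hat{\mathbf B},\hat E)^\top$ and $\check{\mathbf U}=(\check\rho,\check{\mathbf m},\check{\mathbf B},\check E)^\top$ both belong to $\mathcal G$ and satisfy the 1D discrete divergence-free condition $\hat B_1-\check B_1=0$, then for any $\alpha>\alpha_1(\hat{\mathbf U},\check{\mathbf U})$, $$\overline{\mathbf U}:=\frac12\Big(\hat{\mathbf U}-\frac{\mathbf F_1(\hat{\mathbf U})}{\alpha}+\check{\mathbf U}+\frac{\mathbf F_1(\check{\mathbf U})}{\alpha}\Big)\in\mathcal G.$$
   Context: A state is $\mathbf U=(\rho,\mathbf m,\mathbf B,E)^\top\in\mathbb R^8$ with $\rho,E\in\mathbb R$, $\mathbf m,\mathbf B\in\mathbb R^3$. For $\rho>0$ put $\mathbf v=\mathbf m/\rho$, $\mathcal E(\mathbf U)=E-\frac12\big(\frac{|\mathbf m|^2}{\rho}+|\mathbf B|^2\big)$, $e=\mathcal E(\mathbf U)/\rho$, $p=p(\rho,e)$, $p_{tot}=p+\frac{|\mathbf B|^2}{2}$. The equation of state $p(\rho,e)$ is any function such that, whenever $\rho>0$, one has $e>0\Leftrightarrow p(\rho,e)>0$. Admissible states: $\mathcal G=\{\mathbf U:\rho>0,\ \mathcal E(\mathbf U)>0\}$. Flux: $$\mathbf F_i(\mathbf U)=\big(\rho v_i,\ \rho v_i\mathbf v-B_i\mathbf B+p_{tot}\mathbf e_i,\ v_i\mathbf B-B_i\mathbf v,\ v_i(E+p_{tot})-B_i(\mathbf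 v\cdot\mathbf B)\big)^\top,$$ with $\mathbf e_i$ the $i$-th standard unit vector of $\mathbb R^3$. For $\mathbf U,\tilde{\mathbf U}\in\mathcal G$, $\alpha_i(\mathbf U,\tilde{\mathbf U})=\min_{\sigma\in\mathbb R}\alpha_i(\mathbf U,\tilde{\mathbf U};\sigma)$ with $$\alpha_i(\mathbf U,\tilde{\mathbf U};\sigma)=\max\big\{|v_i|+\mathscr C_i,\ |\tilde v_i|+\tilde{\mathscr C}_i,\ |\sigma v_i+(1-\sigma)\tilde v_i|+\max\{\mathscr C_i,\tilde{\mathscr C}_i\}\big\}+\frac{|\tilde{\mathbf B}-\mathbf B|}{\sqrt2}\sqrt{\frac{\sigma^2}{\rho}+\frac{(1-\sigma)^2}{\tilde\rho}},$$ $$\mathscr C_i=\frac1{\sqrt2}\Big[\mathscr C_s^2+\frac{|\mathbf B|^2}{\rho}+\sqrt{\Big(\mathscr C_s^2+\frac{|\mathbf B|^2}{\rho}\Big)^2-4\frac{\mathscr C_s^2B_i^2}{\rho}}\Big]^{1/2},\qquad \mathscr C_s=\frac{p}{\rho\sqrt{2e}},$$ and $\tilde{\mathscr C}_i$ the same quantity for $\tilde{\mathbf U}$. *)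

(* Defs.v *)
From mathcomp Require Import all_boot all_order all_algebra.
From mathcomp Require Import all_classical all_reals all_analysis.
From mathcomp Require Import ring lra.

Set Implicit Arguments.
Unset Strict Implicit.
Unset Printing Implicit Defensive.

Import Order.TTheory GRing.Theory Num.Theory.
Import numFieldNormedType.Exports.
Local Open Scope classical_set_scope.
Local Open Scope ring_scope.

(* The norm `|u| that MathComp-Analysis puts on matrices is the sup norm, hence
   the explicit Euclidean one. *)
Definition dotv (R : realType) (u w : 'cV[R]_3) : R := \sum_k u k 0 * w k 0.

Definition enorm (R : realType) (u : 'cV[R]_3) : R := Num.sqrt (dotv u u).

(* R^8, split into the blocks (rho, m, B, E). *)
Definition state (R : realType) := 'cV[R]_(1 + (3 + (3 + 1))).

Definition mkstate (R : realType) (r : R) (m B : 'cV[R]_3) (E : R) : state R :=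
  col_mx r%:M (col_mx m (col_mx B E%:M)).

Definition density (R : realType) (U : state R) : R := usubmx U 0 0.
Definition momentum (R : realType) (U : state R) : 'cV[R]_3 :=
  usubmx (dsubmx U).
Definition magfield (R : realType) (U : state R) : 'cV[R]_3 :=
  usubmx (dsubmx (dsubmx U)).
Definition energy (R : realType) (U : state R) : R :=
  dsubmx (dsubmx (dsubmx U)) 0 0.

Definition velocity (R : realType) (U : state R) : 'cV[R]_3 :=
  (density U)^-1 *: momentum U.

(* \mathcal E(U), the internal energy per unit volume *)
Definition internal_energy (R : realType) (U : state R) : R :=
  energy U
  - 2^-1 * (enorm (momentum U) ^+ 2 / density U + enorm (magfield U) ^+ 2).

(* e, the internal energy per unit mass *)
Definition specific_energy (R : realType) (U : state R) : R :=
  internal_energy U / density U.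

Definition is_eos (R : realType) (p : R -> R -> R) : Prop :=
  forall rho e, 0 < rho -> (0 < e <-> 0 < p rho e).

Definition pressure (R : realType) (p : R -> R -> R) (U : state R) : R :=
  p (density U) (specific_energy U).

Definition total_pressure (R : realType) (p : R -> R -> R) (U : state R) : R :=
  pressure p U + enorm (magfield U) ^+ 2 / 2.

(* the set \mathcal G *)
Definition admissible (R : realType) : set (state R) :=
  [set U | 0 < density U /\ 0 < internal_energy U].

(* Coordinates are numbered from 0: the flux F_1 is [flux p 0]. *)
Definition flux (R : realType) (p : R -> R -> R) (i : 'I_3) (U : state R)
    : state R :=
  let rho := density U in
  let v := velocity U in
  let B := magfield U in
  let ptot := total_pressure p U in
  mkstate (rho * v i 0)
          ((rho * v i 0) *: v - B i 0 *: B + ptot *: delta_mx i 0)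
          (v i 0 *: B - B i 0 *: v)
          (v i 0 * (energy U + ptot) - B i 0 * dotv v B).

(* \mathscr C_s *)
Definition sound_speed (R : realType) (p : R -> R -> R) (U : state R) : R :=
  pressure p U / (density U * Num.sqrt (2 * specific_energy U)).

(* \mathscr C_i *)
Definition fast_speed (R : realType) (p : R -> R -> R) (i : 'I_3)
    (U : state R) : R :=
  let cs2 := sound_speed p U ^+ 2 in
  let a := cs2 + enorm (magfield U) ^+ 2 / density U in
  (Num.sqrt 2)^-1 *
  Num.sqrt
    (a + Num.sqrt (a ^+ 2 - 4 * (cs2 * magfield U i 0 ^+ 2 / density U))).

(* \alpha_i(U, V; sigma) *)
Definition alpha_sigma (R : realType) (p : R -> R -> R) (i : 'I_3)
    (U V : state R) (s : R) : R :=
  let vU := velocity U i 0 in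
  let vV := velocity V i 0 in
  let cU := fast_speed p i U in
  let cV := fast_speed p i V in
  Num.max (`|vU| + cU)
    (Num.max (`|vV| + cV) (`|s * vU + (1 - s) * vV| + Num.max cU cV))
  + enorm (magfield V - magfield U) / Num.sqrt 2
    * Num.sqrt (s ^+ 2 / density U + (1 - s) ^+ 2 / density V).

(* \alpha_i(U, V); the infimum is a minimum on admissible states, see
   [alpha_attained]. *)
Definition alpha (R : realType) (p : R -> R -> R) (i : 'I_3)
    (U V : state R) : R :=
  inf (range (alpha_sigma p i U V)).

Lemma alpha_sigma_continuous (R : realType) (p : R -> R -> R) (i : 'I_3)
    (U V : state R) : continuous (alpha_sigma p i U V).
Proof.
move=> s; rewrite /alpha_sigma.
have cl (x y : R) : {for s, continuous (fun t : R => t * x + (1 - t) * y)}.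
  apply: cvgD; apply: cvgMr_tmp; first exact: cvg_id.
  by apply: cvgB; [exact: cvg_cst | exact: cvg_id].
have cq (x y : R) :
    {for s, continuous (fun t : R => t ^+ 2 * x + (1 - t) ^+ 2 * y)}.
  apply: cvgD; apply: cvgMr_tmp; first exact: exprn_continuous.
  apply: (@cvg_comp _ _ _ (fun t : R => 1 - t) (fun t => t ^+ 2)); last first.
    exact: exprn_continuous.
  by apply: cvgB; [exact: cvg_cst | exact: cvg_id].
have cm (a b c x y : R) : {for s, continuous (fun t : R =>
    Num.max a (Num.max b (`|t * x + (1 - t) * y| + c)))}.
  apply: (@continuous_max R R (cst a)); first exact: cst_continuous.
  apply: (@continuous_max R R (cst b)); first exact: cst_continuous.
  by apply: cvgD; [exact: (cvg_norm (cl _ _)) | exact: cvg_cst].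
apply: (cvgD (cm _ _ _ _ _)); apply: cvgMl_tmp.
exact: (@continuous_comp _ _ _ _ (@Num.sqrt R) s (cq _ _)
  (@sqrt_continuous _ _)).
Qed.

Lemma alpha_attained (R : realType) (p : R -> R -> R) (i : 'I_3)
    (U V : state R) : admissible U -> admissible V ->
  (exists s, alpha p i U V = alpha_sigma p i U V s) /\
  (forall s, alpha p i U V <= alpha_sigma p i U V s).
Proof.
move=> [rU _] [rV _]; set f := alpha_sigma p i U V.
suff [s0 minf] : exists s0, forall s, f s0 <= f s.
  have fE : alpha p i U V = f s0.
    apply/eqP; rewrite eq_le; apply/andP; split.
      by apply: ge_inf; [exists (f s0) => _ [s _ <-] | exists s0].
    by apply: lb_le_inf; [exists (f s0), s0 | move=> _ [s _ <-]].
  by split=> [|s]; [exists s0 | rewrite fE].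
suff [K K0 fK] : exists2 K, 0 <= K & forall s, K < `|s| -> f 0 <= f s.
  have NK : - K <= K by rewrite ge0_cp.
  have [|c _ minf] := @EVT_min R f _ _ NK.
    exact/continuous_subspaceT/alpha_sigma_continuous.
  exists c => s; have [sK|/fK] := leP `|s| K.
    by apply: minf; rewrite in_itv /= -ler_norml.
  by apply: le_trans; apply: minf; rewrite in_itv /= K0 oppr_le0 K0.
have ge_k s : enorm (magfield V - magfield U) / Num.sqrt 2 *
    (`|s| / Num.sqrt (density U)) <= enorm (magfield V - magfield U) /
    Num.sqrt 2 * Num.sqrt (s ^+ 2 / density U + (1 - s) ^+ 2 / density V).
  apply: ler_wpM2l; first by rewrite divr_ge0 ?sqrtr_ge0.
  rewrite -sqrtr_sqr -sqrtrV ?(ltW rU)// -sqrtrM ?sqr_ge0//.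
  by apply: ler_wsqrtr; rewrite lerDl divr_ge0 ?sqr_ge0 ?ltW.
have k_ge0 : 0 <= enorm (magfield V - magfield U) / Num.sqrt 2.
  by rewrite divr_ge0 ?sqrtr_ge0.
set k := enorm _ / _ in ge_k k_ge0.
set x := velocity U i 0; set y := velocity V i 0.
set c := Num.max (fast_speed p i U) (fast_speed p i V).
have lb1 s : `|x| + fast_speed p i U + k * (`|s| / Num.sqrt (density U)) <= f s.
  by rewrite /f /alpha_sigma -/x -/y -/c -/k lerD// le_max lexx.
have lb2 s : `|s * x + (1 - s) * y| + c <= f s.
  rewrite /f /alpha_sigma -/x -/y -/c -/k -[leLHS]addr0 lerD//.
    by rewrite !le_max lexx !orbT.
  by rewrite mulr_ge0 ?sqrtr_ge0.
have [k0|kn0] := eqVneq k 0; last first.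
  have kp : 0 < k by rewrite lt_neqAle eq_sym kn0.
  have L0 : 0 < k / Num.sqrt (density U) by rewrite divr_gt0 ?sqrtr_gt0.
  exists (`|f 0 - (`|x| + fast_speed p i U)| / (k / Num.sqrt (density U))).
    by rewrite divr_ge0 ?(ltW L0).
  move=> s; rewrite ltr_pdivrMr// => hs; apply: le_trans (lb1 s).
  rewrite mulrCA -lerBlDl; exact/ltW/(le_lt_trans (ler_norm _)).
have [xy|xy] := eqVneq x y.
  have xE t : t * x + (1 - t) * y = x by rewrite -xy; ring.
  by exists 0 => // s _; rewrite /f /alpha_sigma -/x -/y -/k !xE k0 !mul0r.
have L0 : 0 < `|x - y| by rewrite normr_gt0 subr_eq0.
exists ((`|f 0 - c| + `|y|) / `|x - y|); first by rewrite divr_ge0 ?addr_ge0.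
move=> s; rewrite ltr_pdivrMr// => hs; apply: le_trans (lb2 s).
have -> : s * x + (1 - s) * y = s * (x - y) + y by ring.
have := lerB_normD (s * (x - y)) y; rewrite normrM.
have := ler_norm (f 0 - c); lra.
Qed.

(* Main.v *)
Require Import Defs.
From mathcomp Require Import all_boot all_order all_algebra.
From mathcomp Require Import all_classical all_reals all_analysis.
From mathcomp Require Import ring lra.

(** Positivity of the internal energy is a nonlinear constraint, but it is the
    lower envelope of affine ones.  For a trial velocity [v] and a trial field
    [B], the functional [tested v B U] is the scalar product of [U] with
    [(|v|^2/2, -v, -B, 1)], and [tested v B U + |B|^2/2] is the relative energy
    [rho |v(U) - v|^2/2 + internal energy + |B(U) - B|^2/2].  The internal
    energy is its value at the state's own velocity and field, so the averaged
    state is admissible as soon as its density is positive and that affine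
    expression is positive at the state's own [v] and [B].  Being affine, the
    expression can be evaluated term by term on the two states and their
    fluxes.

    By [tested_flux], the tested flux is the sum of a transport term, with
    speed [v_i(U)] on the kinetic and internal part of the relative energy and
    speed [v_i] on the magnetic part; of a quadratic form [wave_form] in the
    deviations; and of [magfield U i 0 * dotv v B - v_i |B|^2/2].  The last
    term cancels in the difference of the two fluxes because the normal fields
    agree: this is where the discrete divergence-free condition is used.  The
    quadratic form is at most the fast magnetosonic speed times the relative
    energy ([wave_form_bound]), because in variables that make the relative
    energy half a squared Euclidean norm, the fast speed is the largest
    eigenvalue of the symmetric matrix of that form.

    What remains is the transport of the magnetic energies by the trial
    velocity, which is arbitrary.  Writing [v_i] as the [s]-weighted mean of
    the two velocities minus the [s]-weighted mean of the deviations gives a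
    speed that [alpha_sigma] contains, and a cubic term.  The latter carries
    the difference of two magnetic energies, and the two magnetic deviations
    differ exactly by the jump of the field; Cauchy's inequality then bounds
    it by the jump term of [alpha_sigma] ([jump_bound]).  Taking for [s] the
    minimizer, [tested_flux_gap] collects the estimates. *)

Set Implicit Arguments.
Unset Strict Implicit.
Unset Printing Implicit Defensive.

Import Order.TTheory GRing.Theory Num.Theory.
Import numFieldNormedType.Exports.
Local Open Scope classical_set_scope.
Local Open Scope ring_scope.

(** * Euclidean products in three dimensions *)

(** The direction [i] of the flux is singled out by name and the two transverse
    ones are [j] and [k], so that coordinate computations can treat all three
    directions at once. *)
Lemma dotv_at (i : 'I_3) :
    exists j k : 'I_3, forall (R : realType) (u w : 'cV[R]_3),
  dotv u w = u i 0 * w i 0 + u j 0 * w j 0 + u k 0 * w k 0.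
Proof.
have dotv3 (R : realType) (u w : 'cV[R]_3) : dotv u w =
    u ord0 0 * w ord0 0 + u (lift ord0 ord0) 0 * w (lift ord0 ord0) 0
    + u ord_max 0 * w ord_max 0.
  rewrite /dotv !big_ord_recl big_ord0 addr0 addrA.
  by congr (_ + _ * _); congr (_ _ _); apply/val_inj.
have [->|->|->] : [\/ i = ord0, i = lift ord0 ord0 | i = ord_max].
- by case: i => -[|[|[|//]]] h;
    [apply: Or31 | apply: Or32 | apply: Or33]; apply/val_inj.
- by exists (lift ord0 ord0), ord_max.
- by exists ord0, ord_max => R u w; rewrite dotv3; ring.
- by exists ord0, (lift ord0 ord0) => R u w; rewrite dotv3; ring.
Qed.

Lemma dotv_ge0 (R : realType) (u : 'cV[R]_3) : 0 <= dotv u u.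
Proof. by apply: sumr_ge0 => k _; rewrite -expr2 sqr_ge0. Qed.

Lemma sqr_enorm (R : realType) (u : 'cV[R]_3) : enorm u ^+ 2 = dotv u u.
Proof. by rewrite sqr_sqrtr// dotv_ge0. Qed.

(** Lagrange's identity: the defect is the squared norm of the cross product. *)
Lemma dotv_cauchy (R : realType) (u w : 'cV[R]_3) :
  dotv u w ^+ 2 <= dotv u u * dotv w w.
Proof.
have [j [k dE]] := dotv_at 0; rewrite !dE -subr_ge0.
set u0 := u 0 0; set u1 := u j 0; set u2 := u k 0.
set w0 := w 0 0; set w1 := w j 0; set w2 := w k 0.
have -> : (u0 * u0 + u1 * u1 + u2 * u2) * (w0 * w0 + w1 * w1 + w2 * w2)
    - (u0 * w0 + u1 * w1 + u2 * w2) ^+ 2 =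
  (u0 * w1 - u1 * w0) ^+ 2 + (u0 * w2 - u2 * w0) ^+ 2 + (u1 * w2 - u2 * w1) ^+ 2.
  by ring.
by rewrite !addr_ge0 ?sqr_ge0.
Qed.

(** * The affine functionals whose lower envelope is the internal energy *)

(** The scalar product of [U] with [(|v|^2/2, -v, -B, 1)]. *)
Definition tested (R : realType) (v B : 'cV[R]_3) (U : state R) : R :=
  density U * (dotv v v / 2) - dotv v (momentum U) - dotv B (magfield U)
  + energy U.

Lemma testedD (R : realType) (v B : 'cV[R]_3) (U V : state R) :
  tested v B (U + V) = tested v B U + tested v B V.
Proof.
have [j [k dE]] := dotv_at 0.
by rewrite /tested !dE /density /momentum /magfield /energy !mxE; ring.
Qed.

Lemma testedZ (R : realType) (v B : 'cV[R]_3) (a : R) (U : state R) :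
  tested v B (a *: U) = a * tested v B U.
Proof.
have [j [k dE]] := dotv_at 0.
by rewrite /tested !dE /density /momentum /magfield /energy !mxE; ring.
Qed.

Lemma tested_self (R : realType) (U : state R) : density U != 0 ->
  tested (velocity U) (magfield U) U + dotv (magfield U) (magfield U) / 2
  = internal_energy U.
Proof.
have [j [k dE]] := dotv_at 0 => r0.
by rewrite /tested /internal_energy !sqr_enorm !dE /velocity !mxE; field.
Qed.

Definition relative_energy (R : realType) (v B : 'cV[R]_3) (U : state R) : R :=
  density U / 2 * dotv (velocity U - v) (velocity U - v) + internal_energy U
  + dotv (magfield U - B) (magfield U - B) / 2.

Lemma tested_relative (R : realType) (v B : 'cV[R]_3) (U : state R) :
  density U != 0 ->
  tested v B U + dotv B B / 2 = relative_energy v B U.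
Proof.
have [j [k dE]] := dotv_at 0 => r0.
rewrite /relative_energy /tested /internal_energy !sqr_enorm !dE /velocity !mxE.
by field.
Qed.

Lemma mkstateK (R : realType) (r : R) (m B : 'cV[R]_3) (E : R) :
  (density (mkstate r m B E) = r) * (momentum (mkstate r m B E) = m)
  * (magfield (mkstate r m B E) = B) * (energy (mkstate r m B E) = E).
Proof.
do !split; rewrite /density /momentum /magfield /energy /mkstate;
  by rewrite ?col_mxKd ?col_mxKu// mxE mulr1n.
Qed.

(** * The flux against a trial velocity and field *)

(** The part of the tested flux that is quadratic in the deviations [w] and [b]
    once the transport terms are removed; the pressure counts as a product of
    the sound speed with the square root of the internal energy. *)
Definition wave_form (R : realType) (p : R -> R -> R) (i : 'I_3) (U : state R)
    (w b : 'cV[R]_3) : R :=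
  pressure p U * w i 0 + w i 0 * dotv (magfield U) b - magfield U i 0 * dotv w b.

(** The magnetic part of the relative energy is moved with the trial speed
    [v i 0] and not with the speed of the state.  This is what leaves a
    remainder, [wave_form], without cubic terms, and what makes the terms in
    [dotv B B] and [dotv v B] depend on [U] through its normal field only. *)
Lemma tested_flux (R : realType) (p : R -> R -> R) (i : 'I_3)
    (v B : 'cV[R]_3) (U : state R) : density U != 0 ->
  let w := velocity U - v in let b := magfield U - B in
  tested v B (flux p i U) =
  velocity U i 0 * (density U / 2 * dotv w w + internal_energy U)
  + v i 0 * (dotv b b / 2) + wave_form p i U w b
  - v i 0 * (dotv B B / 2) + magfield U i 0 * dotv v B.
Proof.
move=> r0 w b; rewrite /tested /flux !mkstateK.
have delta_dot (u : 'cV[R]_3) : dotv u (delta_mx i 0) = u i 0.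
  rewrite /dotv (bigD1 i)//= !mxE !eqxx mulr1 big1 ?addr0// => k ki.
  by rewrite mxE (negbTE ki) mulr0.
have [j [k dE]] := dotv_at i.
have lin (x y z : 'cV[R]_3) (a c d : R) :
    dotv v (a *: x - c *: y + d *: z) =
    a * dotv v x - c * dotv v y + d * dotv v z.
  by rewrite !dE !mxE; ring.
rewrite lin delta_dot.
have mv : momentum U = density U *: velocity U.
  by rewrite /velocity scalerA mulfV// scale1r.
rewrite /wave_form /w /b /internal_energy /total_pressure !sqr_enorm mv !dE.
by rewrite !mxE; field.
Qed.

(** * The fast speed bounds the wave form *)

(** The quadratic [(l - c) * (l - n) - l * t] is nonpositive at [c] and at
    [n], so both lie to the left of its larger root. *)
Lemma larger_root (R : realType) (c n t : R) : 0 <= c -> 0 <= n -> 0 <= t ->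
  let l := 2^-1 * (c + n + t + Num.sqrt ((c + n + t) ^+ 2 - 4 * (c * n))) in
  [/\ c <= l, n <= l & (l - c) * (l - n) = l * t].
Proof.
move=> c0 n0 t0; set d := Num.sqrt _ => l.
have dd : d ^+ 2 = (c + n + t) ^+ 2 - 4 * (c * n).
  rewrite sqr_sqrtr//.
  have -> : (c + n + t) ^+ 2 - 4 * (c * n)
    = (c - n) ^+ 2 + t * (t + 2 * (c + n)) by ring.
  by rewrite addr_ge0 ?sqr_ge0// mulr_ge0//; lra.
have d0 : 0 <= d by exact: sqrtr_ge0.
have prodE : (l - c) * (l - n) = l * t.
  rewrite /l; apply/eqP; rewrite -subr_eq0; apply/eqP.
  have -> : (2^-1 * (c + n + t + d) - c) * (2^-1 * (c + n + t + d) - n)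
     - 2^-1 * (c + n + t + d) * t
     = 4^-1 * (d ^+ 2 - ((c + n + t) ^+ 2 - 4 * (c * n))) by field.
  by rewrite dd subrr mulr0.
have l0 : 0 <= l by rewrite /l; lra.
have lt0 : 0 <= l * t by rewrite mulr_ge0.
have sum0 : 0 <= (l - c) + (l - n) by rewrite /l; lra.
split=> //; rewrite -subr_ge0 leNgt; apply/negP => neg.
- have pos : 0 < l - n by lra.
  suff : (l - c) * (l - n) < 0 by rewrite prodE ltNge lt0.
  by rewrite nmulr_rlt0.
- have pos : 0 < l - c by lra.
  suff : (l - c) * (l - n) < 0 by rewrite prodE ltNge lt0.
  by rewrite pmulr_rlt0.
Qed.

Lemma fast_speed_ge0 (R : realType) (p : R -> R -> R) (i : 'I_3)
  (U : state R) : 0 <= fast_speed p i U.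
Proof. by rewrite /fast_speed mulr_ge0 ?invr_ge0 ?sqrtr_ge0. Qed.

(** The dispersion relation of fast waves: with [c] the squared sound speed,
    [n] and [t] the squared normal and transverse Alfven speeds. *)
Lemma fast_speed_root (R : realType) (p : R -> R -> R) (i : 'I_3)
    (U : state R) : 0 < density U ->
  let l := fast_speed p i U ^+ 2 in
  let c := sound_speed p U ^+ 2 in
  let n := magfield U i 0 ^+ 2 / density U in
  let t := (dotv (magfield U) (magfield U) - magfield U i 0 ^+ 2) / density U in
  [/\ c <= l, n <= l & (l - c) * (l - n) = l * t].
Proof.
move=> r0 l c n t.
have c0 : 0 <= c by exact: sqr_ge0.
have n0 : 0 <= n by rewrite divr_ge0 ?sqr_ge0 ?ltW.
have t0 : 0 <= t.
  have [j [k dE]] := dotv_at i; rewrite /t dE divr_ge0 ?(ltW r0)//.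
  have := sqr_ge0 (magfield U j 0); have := sqr_ge0 (magfield U k 0).
  lra.
suff -> : l = 2^-1 * (c + n + t + Num.sqrt ((c + n + t) ^+ 2 - 4 * (c * n))).
  exact: larger_root.
rewrite /l /fast_speed -/c sqr_enorm.
have -> : dotv (magfield U) (magfield U) / density U = n + t.
  by rewrite /n /t -mulrDl addrC subrK.
rewrite -mulrA -/n !addrA exprMn exprVn !sqr_sqrtr//.
by rewrite !addr_ge0 ?sqrtr_ge0.
Qed.

(** A binary quadratic form with nonpositive discriminant.  Only the square [q]
    of the second variable and its product [z] with half the middle coefficient
    appear, because that variable will be a plane vector. *)
Lemma binary_form_ge0 (R : realType) (A D q x z : R) : 0 <= A -> 0 <= D ->
  0 <= q -> z ^+ 2 <= A * D * q -> 0 <= A * x ^+ 2 - 2 * (x * z) + D * q.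
Proof.
move=> A0 D0 q0 zle; have Dq0 : 0 <= D * q by rewrite mulr_ge0.
move: A0; rewrite le_eqVlt => /predU1P[AE|A0].
  have z0 : z = 0.
    apply/eqP; rewrite -sqrf_eq0 eq_le sqr_ge0 andbT.
    by move: zle; rewrite -AE !mul0r.
  by rewrite -AE z0 mul0r !mulr0 subr0 add0r.
rewrite -(pmulr_rge0 _ A0).
have -> : A * (A * x ^+ 2 - 2 * (x * z) + D * q)
  = (A * x - z) ^+ 2 + (A * D * q - z ^+ 2) by ring.
by rewrite addr_ge0 ?sqr_ge0 ?subr_ge0.
Qed.

(** The witness is [q = sqrt (2 e)]: in this variable the pressure is linear and
    the internal energy quadratic, so the pressure work joins the quadratic
    form.  The equation of state enters only through the sign of the sound
    speed. *)
Lemma admissible_sound_speed (R : realType) (p : R -> R -> R) (U : state R) :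
    is_eos p -> admissible U ->
  exists q, [/\ 0 < sound_speed p U,
    pressure p U = sound_speed p U * density U * q &
    internal_energy U = density U / 2 * q ^+ 2].
Proof.
move=> eos [r0 e0]; have s0 : 0 < specific_energy U by rewrite divr_gt0.
have q0 : 0 < 2 * specific_energy U by rewrite mulr_gt0.
have p0 : 0 < pressure p U by exact: (proj1 (eos _ _ r0) s0).
have sq0 : 0 < Num.sqrt (2 * specific_energy U) by rewrite sqrtr_gt0.
exists (Num.sqrt (2 * specific_energy U)); split.
- by rewrite divr_gt0// mulr_gt0.
- by rewrite /sound_speed; field; rewrite !gt_eqF.
- by rewrite sqr_sqrtr ?ltW// /specific_energy; field; rewrite gt_eqF.
Qed.

(** Completing squares in the transverse velocities and in [q] leaves a form in
    the normal velocity and the transverse field; it is nonnegative because its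
    discriminant vanishes at the fast speed, up to Cauchy's inequality for the
    transverse fields. *)
Lemma wave_form_le (R : realType) (p : R -> R -> R) (i : 'I_3) (U : state R)
    (w b : 'cV[R]_3) : is_eos p -> admissible U ->
  wave_form p i U w b <= fast_speed p i U
    * (density U / 2 * dotv w w + internal_energy U + dotv b b / 2).
Proof.
move=> eos admU; have [q [c0 pE eE]] := admissible_sound_speed eos admU.
case: admU => r0 _; rewrite /wave_form pE eE.
have [cl nl rootE] := fast_speed_root p i r0.
have C0 := fast_speed_ge0 p i U; move: cl nl rootE C0.
have [j [k dE]] := dotv_at i; rewrite !dE.
move: c0 r0; move: (sound_speed p U) (density U) (fast_speed p i U) => c r C.
move: (magfield U i 0) (magfield U j 0) (magfield U k 0) => B0 B1 B2.
move: (w i 0) (w j 0) (w k 0) (b i 0) (b j 0) (b k 0) => w0 w1 w2 b0 b1 b2.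
move=> c0 r0 cl nl rootE; rewrite le_eqVlt => /predU1P[CE|C0].
  by exfalso; move: cl; rewrite -CE expr0n/= leNgt exprn_gt0.
(* The squared middle coefficient involves [B1 * b1 + B2 * b2], bounded by
   Cauchy's inequality in the plane transverse to the flux. *)
have tr := @binary_form_ge0 _ (r * (C ^+ 2 - c ^+ 2)) (C ^+ 2 - B0 ^+ 2 / r)
   (b1 ^+ 2 + b2 ^+ 2) w0 (C * (B1 * b1 + B2 * b2)).
rewrite -subr_ge0 -(pmulr_rge0 _ C0) -(pmulr_rge0 _ (ltr0Sn R 1)).
set lhs := (X in 0 <= X).
have -> : lhs = (r * (C * w1) + B0 * b1) ^+ 2 / r
  + (r * (C * w2) + B0 * b2) ^+ 2 / r
  + r * (C * q - c * w0) ^+ 2 + (C * b0) ^+ 2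
  + (r * (C ^+ 2 - c ^+ 2) * w0 ^+ 2 - 2 * (w0 * (C * (B1 * b1 + B2 * b2)))
     + (C ^+ 2 - B0 ^+ 2 / r) * (b1 ^+ 2 + b2 ^+ 2)).
  by rewrite /lhs; field; rewrite gt_eqF.
apply: addr_ge0.
  do !apply: addr_ge0; rewrite ?sqr_ge0// mulr_ge0 ?sqr_ge0 ?invr_ge0//;
  exact: ltW.
apply: tr.
- by rewrite mulr_ge0 ?(ltW r0)// subr_ge0.
- by rewrite subr_ge0.
- by rewrite addr_ge0 ?sqr_ge0.
- rewrite -(mulrA r) rootE -subr_ge0.
  set d := (X in 0 <= X).
  have -> : d = C ^+ 2 * (B1 * b2 - B2 * b1) ^+ 2.
    by rewrite /d; field; rewrite gt_eqF.
  by rewrite mulr_ge0 ?sqr_ge0.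
Qed.

(** The wave form is odd in [w] and the relative energy is even. *)
Lemma wave_form_bound (R : realType) (p : R -> R -> R) (i : 'I_3) (U : state R)
    (w b : 'cV[R]_3) : is_eos p -> admissible U ->
  `|wave_form p i U w b| <= fast_speed p i U
    * (density U / 2 * dotv w w + internal_energy U + dotv b b / 2).
Proof.
move=> eos admU; rewrite ler_norml wave_form_le// andbT lerNl.
have -> : - wave_form p i U w b = wave_form p i U (- w) b.
  by have [j [k dE]] := dotv_at i; rewrite /wave_form !dE !mxE; ring.
have -> : dotv w w = dotv (- w) (- w).
  by have [j [k dE]] := dotv_at i; rewrite !dE !mxE; ring.
exact: wave_form_le.
Qed.

(** * The jump of the magnetic field *)
Lemma sqr_le_norm (R : realType) (x y : R) : 0 <= y -> x ^+ 2 <= y ^+ 2 ->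
  `|x| <= y.
Proof. by move=> y0; rewrite -(real_normK (num_real x)) ler_sqr ?nnegrE. Qed.

(** Cauchy's inequality twice: once for the weighted mean of the velocities,
    in the norm weighted by the densities, once for
    [|b|^2 - |b'|^2 = - (b' - b) . (b' + b)]; the parallelogram law and the
    inequality between arithmetic and geometric means then produce the sum of
    energies. *)
Lemma jump_bound (R : realType) (i : 'I_3) (r r' s : R)
    (w w' b b' : 'cV[R]_3) : 0 < r -> 0 < r' ->
  `|(s * w i 0 + (1 - s) * w' i 0) * ((dotv b b - dotv b' b') / 2)|
  <= enorm (b' - b) / Num.sqrt 2 * Num.sqrt (s ^+ 2 / r + (1 - s) ^+ 2 / r')
     * (r / 2 * dotv w w + dotv b b / 2
        + (r' / 2 * dotv w' w' + dotv b' b' / 2)).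
Proof.
move=> r0 r0'; set S2 := s ^+ 2 / r + _.
have S0 : 0 <= S2 by rewrite addr_ge0 ?divr_ge0 ?sqr_ge0 ?ltW.
set X := r * dotv w w + r' * dotv w' w'.
set Y := dotv b b + dotv b' b'.
have X0 : 0 <= X by rewrite addr_ge0 ?mulr_ge0 ?dotv_ge0 ?(ltW r0) ?(ltW r0').
have Y0 : 0 <= Y by rewrite addr_ge0 ?dotv_ge0.
have -> : r / 2 * dotv w w + dotv b b / 2
  + (r' / 2 * dotv w' w' + dotv b' b' / 2) = (X + Y) / 2.
  by rewrite /X /Y; field.
apply: sqr_le_norm.
  by rewrite !mulr_ge0 ?invr_ge0 ?sqrtr_ge0// addr_ge0.
rewrite !exprMn !exprVn sqr_enorm !sqr_sqrtr//.
set J := dotv (b' - b) (b' - b).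
have J0 : 0 <= J by exact: dotv_ge0.
have velocity_le : (s * w i 0 + (1 - s) * w' i 0) ^+ 2 <= S2 * X.
  have comp (u : 'cV[R]_3) : u i 0 ^+ 2 <= dotv u u.
    have [j [k dE]] := dotv_at i; rewrite dE.
    by have := sqr_ge0 (u j 0); have := sqr_ge0 (u k 0); lra.
  apply: (@le_trans _ _ (S2 * (r * w i 0 ^+ 2 + r' * w' i 0 ^+ 2))).
    rewrite -subr_ge0; set d := (X in 0 <= X).
    have -> : d = (s * r' * w' i 0 - (1 - s) * r * w i 0) ^+ 2 / (r * r').
      by rewrite /d /S2; field; rewrite !gt_eqF.
    by rewrite divr_ge0 ?sqr_ge0// mulr_ge0 ?ltW.
  by rewrite ler_wpM2l// lerD// ler_wpM2l ?comp ?ltW.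
have field_le : (dotv b b - dotv b' b') ^+ 2 <= 2 * J * Y.
  have [j [k dE]] := dotv_at i.
  have -> : dotv b b - dotv b' b' = - dotv (b' - b) (b' + b).
    by rewrite !dE !mxE; ring.
  have parallelogram : dotv (b' + b) (b' + b) = 2 * Y - J.
    by rewrite /Y /J !dE !mxE; ring.
  rewrite sqrrN (le_trans (dotv_cauchy _ _))// parallelogram -/J.
  by have := sqr_ge0 J; lra.
apply: (@le_trans _ _ (S2 * X * (2 * J * Y * (2 ^+ 2)^-1))).
  apply: ler_pM => //; first exact: sqr_ge0.
    by rewrite divr_ge0 ?sqr_ge0.
  by rewrite ler_wpM2r ?invr_ge0 ?sqr_ge0.
rewrite -subr_ge0; set d := (X in 0 <= X).
have -> : d = J * S2 * (X - Y) ^+ 2 / 8 by rewrite /d; field.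
by rewrite divr_ge0// mulr_ge0 ?sqr_ge0// mulr_ge0.
Qed.

(** * Admissibility of the Lax-Friedrichs average *)
Lemma relative_energy_gt0 (R : realType) (v B : 'cV[R]_3) (U : state R) :
  admissible U -> 0 < relative_energy v B U.
Proof.
move=> [r0 e0]; rewrite /relative_energy.
have := dotv_ge0 (velocity U - v); have := dotv_ge0 (magfield U - B).
move=> b0 w0; have : 0 <= density U / 2 * dotv (velocity U - v) (velocity U - v).
  by rewrite mulr_ge0// divr_ge0 ?ltW.
lra.
Qed.

(** Linear form of the splitting property: this is the strict positivity of the
    tested average, multiplied by [2 a]. *)
Lemma tested_flux_gap (R : realType) (p : R -> R -> R) (i : 'I_3)
    (U V : state R) (v B : 'cV[R]_3) (a : R) :
    is_eos p -> admissible U -> admissible V ->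
    magfield U i 0 = magfield V i 0 -> alpha p i U V < a ->
  tested v B (flux p i U) - tested v B (flux p i V)
  < a * (relative_energy v B U + relative_energy v B V).
Proof.
move=> eos admU admV divfree alphaa.
have [[s alphaE] _] := alpha_attained p i admU admV.
move: alphaa; rewrite {}alphaE /alpha_sigma => alphaa.
have := relative_energy_gt0 v B admU; have := relative_energy_gt0 v B admV.
have [rU eU] := admU; have [rV eV] := admV.
rewrite !tested_flux ?gt_eqF// divfree /relative_energy.
set w := velocity U - v; set w' := velocity V - v.
set b := magfield U - B; set b' := magfield V - B.
have := wave_form_bound i w b eos admU.
have := wave_form_bound i w' b' eos admV.
have := jump_bound i s w w' b b' rU rV.
have -> : b' - b = magfield V - magfield U by rewrite /b /b' opprB addrA subrK.
move: alphaa; set J := enorm _ / _ * _; set m := Num.max _ _.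
have mU : `|velocity U i 0| + fast_speed p i U <= m by rewrite le_max lexx.
have mV : `|velocity V i 0| + fast_speed p i V <= m.
  by rewrite !le_max lexx orbT.
set vs := s * velocity U i 0 + (1 - s) * velocity V i 0 in m mU mV *.
have msU : `|vs| + fast_speed p i U <= m.
  by rewrite /m !le_max lerD2l le_max lexx !orbT.
have msV : `|vs| + fast_speed p i V <= m.
  by rewrite /m !le_max lerD2l le_max lexx !orbT.
(* The trial speed is unbounded, so it is traded for the mean speed [vs]
   minus the mean of the deviations, which the energies control. *)
have viE : v i 0 = vs - (s * w i 0 + (1 - s) * w' i 0).
  by rewrite /vs /w /w' !mxE; ring.
have KU0 : 0 <= density U / 2 * dotv w w.
  by rewrite mulr_ge0 ?dotv_ge0// divr_ge0 ?ltW.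
have KV0 : 0 <= density V / 2 * dotv w' w'.
  by rewrite mulr_ge0 ?dotv_ge0// divr_ge0 ?ltW.
have MU0 := dotv_ge0 b; have MV0 := dotv_ge0 b'.
rewrite viE.
move: (internal_energy U) (internal_energy V) eU eV => e e' e0 e0'.
move: KU0 KV0 (dotv b b) (dotv b' b') MU0 MV0.
move: (density U / 2 * _) (density V / 2 * _) => K K' K0 K0' M M' M0 M0'.
move: (wave_form _ _ U _ _) (wave_form _ _ V _ _) => W W'.
move: (s * w i 0 + _) => g am.
rewrite !ler_norml => /andP[g1 _] /andP[V1 _] /andP[_ U2].
have P0 : 0 <= K + e by rewrite addr_ge0 ?(ltW e0).
have P0' : 0 <= K' + e' by rewrite addr_ge0 ?(ltW e0').
have hU := ler_wpM2r P0 mU; have hV := ler_wpM2r P0' mV.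
have hsU := ler_wpM2r M0 msU; have hsV := ler_wpM2r M0' msV.
have hvU := ler_wpM2r P0 (ler_norm (velocity U i 0)).
have hvV := ler_wpM2r P0' (ler_norm (- velocity V i 0)).
have hvsU := ler_wpM2r M0 (ler_norm vs).
have hvsV := ler_wpM2r M0' (ler_norm (- vs)).
rewrite !normrN in hvV hvsV.
move=> qV qU.
have ha : (m + J) * (K + e + M / 2 + (K' + e' + M' / 2))
    < a * (K + e + M / 2 + (K' + e' + M' / 2)).
  by rewrite ltr_pM2r ?(addr_gt0 qU qV).
have J0 : 0 <= J by rewrite /J !mulr_ge0 ?invr_ge0 ?sqrtr_ge0.
have hJ : 0 <= J * (e + e') by rewrite mulr_ge0 ?addr_ge0 ?(ltW e0) ?(ltW e0').
clear -g1 V1 U2 hU hV hsU hsV hvU hvV hvsU hvsV ha hJ.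
lra.
Qed.

Theorem lax_friedrichs_admissible (R : realType) (p : R -> R -> R) (i : 'I_3)
    (U V : state R) (a : R) :
    is_eos p -> admissible U -> admissible V ->
    magfield U i 0 = magfield V i 0 -> alpha p i U V < a ->
  admissible (2^-1 *: (U - a^-1 *: flux p i U + V + a^-1 *: flux p i V)).
Proof.
move=> eos admU admV divfree alphaa; have [rU eU] := admU; have [rV eV] := admV.
set W := _ *: _.
(* The density only needs the part of [alpha_sigma] that bounds the speeds. *)
have speed_lt : Num.max `|velocity U i 0| `|velocity V i 0| < a.
  have [[s alphaE] _] := alpha_attained p i admU admV.
  move: alphaa; rewrite alphaE; apply: le_lt_trans.
  rewrite /alpha_sigma -[leLHS]addr0 lerD//; last first.
    by rewrite !mulr_ge0 ?invr_ge0 ?sqrtr_ge0.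
  by rewrite !(ge_max, le_max) !lerDl !fast_speed_ge0 ?orbT.
have a0 : 0 < a by apply: le_lt_trans speed_lt; rewrite le_max normr_ge0.
move: speed_lt; rewrite gt_max => /andP[].
move=> /ltr_normlP[_ vU_lt] /ltr_normlP[vV_gt _].
have densW : density W = 2^-1 * (density U * (1 - a^-1 * velocity U i 0)
    + density V * (1 + a^-1 * velocity V i 0)).
  rewrite /W.
  have densE (x y z t : state R) (c d e : R) :
      density (c *: (x - d *: y + z + e *: t)) =
      c * (density x - d * density y + density z + e * density t).
    by rewrite /density !mxE.
  by rewrite densE /flux !mkstateK; ring.
have rW : 0 < density W.
  rewrite densW mulr_gt0// addr_gt0// mulr_gt0//.
    by rewrite subr_gt0 mulrC ltr_pdivrMr// mul1r.
  have : - 1 < a^-1 * velocity V i 0 by rewrite mulrC ltr_pdivlMr// mulN1r; lra.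
  lra.
(* The average is tested at its own velocity and field, where the affine bound
   is attained. *)
split=> //; rewrite -(tested_self (lt0r_neq0 rW)).
set v := velocity W; set B := magfield W; rewrite /W -scaleNr.
rewrite testedZ !testedD !testedZ.
have := tested_flux_gap v B eos admU admV divfree alphaa.
rewrite -!tested_relative ?gt_eqF// -ltr_pdivrMl// mulrBr; lra.
Qed.

Theorem theorem2p11 (R : realType) (p : R -> R -> R) (p_eos : is_eos p)
    (Uhat Ucheck : state R)
    (Uhat_adm : admissible Uhat) (Ucheck_adm : admissible Ucheck)
    (div_free : magfield Uhat 0 0 - magfield Ucheck 0 0 = 0)
    (a : R) (a_gt : alpha p 0 Uhat Ucheck < a) :
  admissible (2^-1 *: (Uhat - a^-1 *: flux p 0 Uhat
                       + Ucheck + a^-1 *: flux p 0 Ucheck)).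
Proof.
by apply: lax_friedrichs_admissible => //; exact: subr0_eq.
Qed.
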